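(* Let $\Sigma_{\mathbf{A}}\subseteq\Sigma=\mathcal{A}^{\mathbb{N}}$ be an aperiodic and irreducible subshift of finite type, and let $(\phi_i)_{i\ge0}$ be a sequence of uniformly equicontinuous potentials $\phi_i\colon\Sigma_{\mathbf{A}}\to\mathbb{R}$. Assume that the limit $A(\mathbf{i})=\lim_{n\to\infty}\frac1n\sum_{i=0}^{n-1}\phi_i(\sigma^i\mathbf{i})$ takes at least two different values (over those $\mathbf{i}\in\Sigma_{\mathbf{A}}$ for which it exists); that is, the domain of $\alpha\mapsto h_{\rm top}(L_{\mathbf{A}}(\alpha))$ is a nontrivial interval. Let $$D=\Big\{\mathbf{i}\in\Sigma_{\mathbf{A}}:\lim_{n\to\infty}\frac1n\sum_{k=0}^{n-1}\phi_k(\sigma^k\mathbf{i})\text{ does not exist}\Big\}.$$ Then $h_{\rm top}(D)=h_{\rm top}(\Sigma_{\mathbf{A}})$.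
   Context: $\mathbb{N}=\{0,1,2,\dots\}$, $\mathcal{A}=\{1,\dots,K\}$ is a finite alphabet, $\Sigma=\mathcal{A}^{\mathbb{N}}$, and $\sigma$ is the left shift. For a finite word $\mathbf{i}$, $[\mathbf{i}]$ is the cylinder of sequences starting with $\mathbf{i}$, whose level $l([\mathbf{i}])$ is the length of $\mathbf{i}$. For a $K\times K$ matrix $\mathbf{A}$ with entries in $\{0,1\}$, the subshift of finite type is $\Sigma_{\mathbf{A}}=\{\mathbf{i}=(i_0,i_1,\dots)\in\Sigma:\mathbf{A}_{i_k,i_{k+1}}=1\ \forall k\ge 0\}$; every symbol of $\mathcal{A}$ is assumed to occur in some element of $\Sigma_{\mathbf{A}}$. It is aperiodic and irreducible if there is $r\ge1$ such that all entries of $\mathbf{A}^r$ are strictly positive. Potentials are continuous functions. The sequence $(\phi_i)$ is uniformly equicontinuous if $\rho^{(1)}_n:=\sup_i \mathrm{var}_n(\phi_i)$ is finite for every $n\in\mathbb{N}$ and $\rho^{(1)}_n\to0$ as $n\to\infty$, where $\mathrm{var}_n(\phi)$ is the supremum of $|\phi(\mathbf{j})-\phi(\mathbf{k})|$ over all $\mathbf{j},\mathbf{k}\in\Sigma_{\mathbf{A}}$ lying in a common cylinder of level $n$ (for $n=0$: over all $\mathbf{j},\mathbf{k}\in\Sigma_{\mathbf{A}}$). $L_{\mathbf{A}}(\alpha)=\{\mathbf{i}\in\Sigma_{\mathbf{A}}:\lim_{n\to\infty}\frac1n\sum_{i=0}^{n-1}\phi_i(\sigma^i\mathbf{i})=\alpha\}$;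 the domain of $\alpha\mapsto h_{\rm top}(L_{\mathbf{A}}(\alpha))$ is $\{\alpha: L_{\mathbf{A}}(\alpha)\ne\emptyset\}$. Topological entropy of $E\subseteq\Sigma$: let $\mathcal{H}^s_r(E)=\inf\sum_{C}e^{-s\,l(C)}$, the infimum over all covers of $E$ by cylinders of level larger than $r$; $\mathcal{H}^s(E)=\lim_{r\to\infty}\mathcal{H}^s_r(E)$; $h_{\rm top}(E)=\inf\{s\ge0:\mathcal{H}^s(E)<\infty\}$ for $E\ne\emptyset$, and $h_{\rm top}(\emptyset)=-\infty$. *)

(* Defs.v *)
From HB Require Import structures.
From mathcomp Require Import all_boot all_order all_algebra.
From mathcomp Require Import all_classical all_reals all_analysis.

Set Implicit Arguments.
Unset Strict Implicit.
Unset Printing Implicit Defensive.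

Import Order.TTheory GRing.Theory Num.Theory.
Import numFieldNormedType.Exports.

Local Open Scope classical_set_scope.
Local Open Scope ring_scope.

(* The alphabet {1, ..., K} is encoded as 'I_K = {0, ..., K-1}. *)
Definition fullshift (K : nat) : topologicalType :=
  prod_topology (fun _ : nat => discrete_topology 'I_K).

Definition left_shift (K : nat) (x : fullshift K) : fullshift K := fun k => x k.+1.

Definition cylinder (K : nat) (w : seq 'I_K) : set (fullshift K) :=
  [set x | mkseq x (size w) = w].

Definition zero_one_mx (K : nat) (A : 'M[nat]_K) : Prop :=
  forall a b, A a b = 0%N \/ A a b = 1%N.

Definition subshift (K : nat) (A : 'M[nat]_K) : set (fullshift K) :=
  [set x | forall k, A (x k) (x k.+1) = 1%N].

Definition every_symbol_occurs (K : nat) (A : 'M[nat]_K) : Prop :=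
  forall a : 'I_K, exists2 x, subshift A x & exists k, x k = a.

Definition aperiodic_irreducible (K : nat) (A : 'M[nat]_K) : Prop :=
  exists2 r : nat, (1 <= r)%N & forall a b, (0 < (A ^+ r) a b)%N.

(* A potential on [subshift A] is represented by a function on the whole of
   [fullshift K], of which only the values on [subshift A] are ever used. *)

Definition var (R : realType) (K : nat) (A : 'M[nat]_K) (n : nat)
    (f : fullshift K -> R) : \bar R :=
  ereal_sup [set v | exists x y, [/\ subshift A x, subshift A y,
    (exists w : seq 'I_K, [/\ size w = n, cylinder w x & cylinder w y]) &
    v = `|f x - f y|%:E]].

Definition sup_var (R : realType) (K : nat) (A : 'M[nat]_K)
    (phi : nat -> fullshift K -> R) (n : nat) : \bar R :=
  ereal_sup (range (fun i => var A n (phi i))).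

Definition uniformly_equicontinuous (R : realType) (K : nat) (A : 'M[nat]_K)
    (phi : nat -> fullshift K -> R) : Prop :=
  (forall n, sup_var A phi n \is a fin_num) /\
  sup_var A phi n @[n --> \oo] --> 0%E.

Definition average (R : realType) (K : nat) (phi : nat -> fullshift K -> R)
    (x : fullshift K) (n : nat) : R :=
  n%:R^-1 * \sum_(0 <= i < n) phi i (iter i (@left_shift K) x).

Definition level_set (R : realType) (K : nat) (A : 'M[nat]_K)
    (phi : nat -> fullshift K -> R) (alpha : R) : set (fullshift K) :=
  [set x | subshift A x /\ average phi x n @[n --> \oo] --> alpha].

Definition divergence_set (R : realType) (K : nat) (A : 'M[nat]_K)
    (phi : nat -> fullshift K -> R) : set (fullshift K) :=
  [set x | subshift A x /\ ~ cvg (average phi x n @[n --> \oo])].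

(* Families of cylinders are indexed by sets of words: a cylinder does not
   determine its level when K = 1. *)
Definition cylinder_cover (K : nat) (r : nat) (E : set (fullshift K))
    (C : set (seq 'I_K)) : Prop :=
  (forall w, C w -> (r < size w)%N) /\ E `<=` \bigcup_(w in C) cylinder w.

Definition hausdorff_level (R : realType) (K : nat) (s : R)
    (E : set (fullshift K)) (r : nat) : \bar R :=
  ereal_inf [set \esum_(w in C) (expR (- s * (size w)%:R))%:E
            | C in cylinder_cover r E].

Definition hausdorff_measure (R : realType) (K : nat) (s : R)
    (E : set (fullshift K)) : \bar R :=
  limn (hausdorff_level s E).

Definition htop (R : realType) (K : nat) (E : set (fullshift K)) : \bar R :=
  if E == set0 then -oo%E
  else ereal_inf [set s%:E | s in
         [set s : R | 0 <= s /\ (hausdorff_measure s E < +oo)%E]].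

(* Main.v *)
(** Let x and y be points whose averages converge to alpha <> beta.  For large L
    and B, reserve the sparse blocks of times [L B^k, (L+1) B^k), k >= 1.  Given
    any u in the subshift, spell out the symbols of u one after another at the
    unreserved times, and on the k-th block copy x (k even) or y (k odd), up to
    connecting words of bounded length.  If the averages of the resulting z
    converged to gamma, then comparing the sums up to the two ends of the long
    blocks copied from x would give gamma = alpha by equicontinuity, and likewise
    gamma = beta; so z lies in the divergence set.  Deleting the reserved
    positions recovers a prefix of u from a prefix of z of length n, and shortens
    it only to length >= (1 - 2/L) n.  A cover of the divergence set by cylinders
    thus becomes a cover of the subshift, whence
    h(subshift) <= h(divergence set) / (1 - 2/L) for all L. *)
Require Import Defs.
From mathcomp Require Import all_boot all_order all_algebra.
From mathcomp Require Import all_classical all_reals all_analysis.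
From mathcomp Require Import zify ring lra.
Import Order.TTheory GRing.Theory Num.Theory.
Import numFieldNormedType.Exports.
Local Open Scope classical_set_scope.
Local Open Scope ring_scope.

(** * Connecting words of the subshift *)

(** A positive entry of [A ^+ r.+1] has a positive term [A a c * (A ^+ r) c b]; this [c] is the
    second vertex of the path. *)
Lemma connecting_path (K : nat) (A : 'M[nat]_K) (hA : zero_one_mx A) (r : nat)
    (a b : 'I_K) : (0 < (A ^+ r) a b)%N ->
  exists v : nat -> 'I_K,
    [/\ v 0%N = a, v r = b & forall t, (t < r)%N -> A (v t) (v t.+1) = 1%N].
Proof.
elim: r a => [|r IH] a.
  rewrite expr0 mxE; case: eqP => // -> _.
  by exists (fun=> b).
rewrite exprS mxE lt0n sum_nat_eq0 negb_forall => /existsP[c].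
rewrite implyTb -lt0n muln_gt0 => /andP[Aac /IH[v [v0 vr vA]]].
exists (fun t => if t is t'.+1 then v t' else a); split=> // -[_|t]; last exact: vA.
by rewrite v0; case: (hA a c) Aac => ->.
Qed.

(** The outer [r] symbols on each side come from paths leading from [a] into [w] and from [w] to
    [b]. As [v] lies strictly between [a] and [b], the first path loses its initial vertex and the
    second its final one. *)
Lemma bridge (K : nat) (A : 'M[nat]_K) (r M p : nat)
    (hconn : forall a b : 'I_K, exists v : nat -> 'I_K,
      [/\ v 0%N = a, v r = b & forall t, (t < r)%N -> A (v t) (v t.+1) = 1%N])
    (w : fullshift K) (a b : 'I_K) :
  (0 < r)%N -> (r.*2 <= M)%N -> subshift A w ->
  exists v : nat -> 'I_K,
    [/\ A a (v 0%N) = 1%N, A (v M.-1) b = 1%N,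
        forall t, (t.+1 < M)%N -> A (v t) (v t.+1) = 1%N &
        forall t, (r <= t < M - r)%N -> v t = w (p + t)%N].
Proof.
move=> r0 rM wA.
have [v1 [v10 v1r v1A]] := hconn a (w (p + r.-1)%N).
have [v2 [v20 v2r v2A]] := hconn (w (p + (M - r))%N) b.
exists (fun t => if (t < r)%N then v1 t.+1
  else if (t < M - r)%N then w (p + t)%N else v2 (t - (M - r))%N); split.
- by rewrite r0 -v10; exact: v1A.
- do 2 (rewrite ifN; last by lia).
  by rewrite -v2r -{2}(prednK r0) -[X in A (v2 X)]/(M.-1 - (M - r))%N
    (_ : M.-1 - (M - r) = r.-1)%N; [apply: v2A; lia | lia].
- move=> t tM.
  case: (ltnP t.+1 r) => h1; first by rewrite ltnW//; exact: v1A.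
  case: (ltnP t r) => h2.
    have et : t = r.-1 by lia.
    have -> : v1 t.+1 = w (p + t)%N by rewrite et prednK// v1r.
    case: ltnP => h3; first by rewrite addnS; exact: wA.
    have -> : (t.+1 - (M - r) = 0)%N by lia.
    by rewrite v20 (_ : p + (M - r) = (p + t).+1)%N; [exact: wA | lia].
  case: (ltnP t (M - r)%N) => h3.
    case: ltnP => h4; first by rewrite addnS; exact: wA.
    have -> : (t.+1 - (M - r) = 0)%N by lia.
    by rewrite v20 (_ : p + (M - r) = (p + t).+1)%N; [exact: wA | lia].
  rewrite ifN; last by lia.
  rewrite (_ : t.+1 - (M - r) = (t - (M - r)).+1)%N; last by lia.
  by apply: v2A; lia.
- move=> t /andP[rt tM].
  by rewrite ltnNge rt /= tM.
Qed.

(** * Sparse reserved blocks and their density *)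

(* The reserved times i are those in [L B^k, (L+1) B^k) for some k >= 1; when
   L + 1 < B, such a k can only be the integer part of log_B i. *)
Definition in_block (L B i : nat) : bool :=
  (B <= i)%N && (L * B ^ trunc_log B i <= i < L.+1 * B ^ trunc_log B i)%N.

(* The number of symbols of u spelled out by z before time n. *)
Definition free_count (L B n : nat) : nat :=
  count (predC (in_block L B)) (iota 0 n).

Lemma free_countS (L B n : nat) :
  free_count L B n.+1 = (free_count L B n + ~~ in_block L B n)%N.
Proof. by rewrite /free_count -addn1 iotaD count_cat /= addn0. Qed.

Lemma trunc_log_block (L B k i : nat) : (0 < L)%N -> (L.+1 < B)%N ->
  (L * B ^ k <= i < L.+1 * B ^ k)%N -> trunc_log B i = k.
Proof.
move=> L0 LB /andP[h1 h2]; apply: trunc_log_eq; first by lia.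
apply/andP; split; first by apply: leq_trans h1; rewrite leq_pmull.
by apply: leq_trans h2 _; rewrite expnS leq_mul2r ltnW ?orbT.
Qed.

Lemma in_blockP (L B i : nat) : (0 < L)%N -> (L.+1 < B)%N ->
  reflect (exists2 k, (0 < k)%N & (L * B ^ k <= i < L.+1 * B ^ k)%N)
          (in_block L B i).
Proof.
move=> L0 LB; apply: (iffP andP) => [[Bi h]|[k k0 h]].
  exists (trunc_log B i) => //; by rewrite trunc_log_gt0; apply/andP; split; clear h; lia.
rewrite (trunc_log_block _ _ _ _ L0 LB h); split=> //.
case/andP: h => h _; apply: leq_trans h.
case: k k0 => // k _; rewrite expnS.
by apply: (leq_trans (leq_pmulr _ _) (leq_pmull _ _)) => //; rewrite expn_gt0; lia.
Qed.

(** Filling block [k] by [bridge] with offset [L * B ^ k] keeps the symbols of [w k] at their own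
    times, so that [z] and [w k] can be compared under the same shifts. *)
Lemma glue_blocks (K : nat) (A : 'M[nat]_K) (r L B : nat)
    (hconn : forall a b : 'I_K, exists v : nat -> 'I_K,
      [/\ v 0%N = a, v r = b & forall t, (t < r)%N -> A (v t) (v t.+1) = 1%N])
    (w : nat -> fullshift K) (u : fullshift K) :
  (0 < r)%N -> (0 < L)%N -> (L.+1 < B)%N -> (r.*2 <= B)%N ->
  (forall k, subshift A (w k)) -> subshift A u ->
  exists z : fullshift K, [/\ subshift A z,
    forall i, ~~ in_block L B i -> z i = u (free_count L B i) &
    forall k i, (0 < k)%N ->
      (L * B ^ k + r <= i < L.+1 * B ^ k - r)%N -> z i = w k i].
Proof.
move=> r0 L0 LB rB wA uA.
have B0 k : (0 < B ^ k)%N by rewrite expn_gt0; lia.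
have BS k : (0 < k)%N -> (B <= B ^ k)%N.
  by case: k => // k _; rewrite expnS leq_pmulr.
have /choice[v vP] : forall k, exists v : nat -> 'I_K, (0 < k)%N ->
    [/\ A (u (free_count L B (L * B ^ k).-1)) (v 0%N) = 1%N,
        A (v (B ^ k).-1) (u (free_count L B (L.+1 * B ^ k))) = 1%N,
        forall t, (t.+1 < B ^ k)%N -> A (v t) (v t.+1) = 1%N &
        forall t, (r <= t < B ^ k - r)%N -> v t = w k (L * B ^ k + t)%N].
  (* There is no block for [k = 0], so the choice there is arbitrary. *)
  move=> [|k]; first by exists (fun=> u 0%N).
  have [|v vP] := bridge K A r (B ^ k.+1) (L * B ^ k.+1) hconn (w k.+1)
    (u (free_count L B (L * B ^ k.+1).-1))
    (u (free_count L B (L.+1 * B ^ k.+1))) r0 _ (wA k.+1).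
    by apply: leq_trans rB _; exact: BS.
  by exists v.
pose z : fullshift K := fun i => if in_block L B i
  then v (trunc_log B i) (i - L * B ^ trunc_log B i)%N
  else u (free_count L B i).
have zin k i : (0 < k)%N -> (L * B ^ k <= i < L.+1 * B ^ k)%N ->
    z i = v k (i - L * B ^ k)%N.
  move=> k0 ik; rewrite /z (trunc_log_block _ _ _ _ L0 LB ik) ifT//.
  by apply/in_blockP => //; exists k.
have zout i : ~~ in_block L B i -> z i = u (free_count L B i).
  by rewrite /z => /negbTE ->.
exists z; split=> //; last first.
  move=> k i k0 /andP[h1 h2].
  rewrite (zin k) //; last by rewrite mulSn in h2 *; lia.
  have [_ _ _ ->] := vP _ k0; last by rewrite mulSn in h2; lia.
  by congr (w k _); lia.
move=> i.
have [/in_blockP[]// k k0 ik|ni] := boolP (in_block L B i).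
  have [v1 v2 v3 v4] := vP _ k0.
  rewrite (zin k)//.
  have [hi|hi] := ltnP i.+1 (L.+1 * B ^ k)%N.
    rewrite (zin k)//; last by lia.
    by rewrite subSn; [apply: v3; rewrite mulSn in hi; lia | lia].
  have ei : i.+1 = (L.+1 * B ^ k)%N by lia.
  (* The time [L.+1 * B ^ k] is below [B ^ k.+1], so only block [k] could contain it, and that block
     has just ended: blocks never touch. *)
  rewrite zout; last first.
    apply/negP => /in_blockP[]// k' k'0 ik'.
    have e1 : trunc_log B i.+1 = k.
      apply: trunc_log_eq; first by lia.
      by rewrite ei expnS leq_pmull// ltn_mul2r LB B0.
    have e2 := trunc_log_block _ _ _ _ L0 LB ik'.
    by rewrite -e2 e1 in ik'; lia.
  rewrite ei (_ : i - L * B ^ k = (B ^ k).-1)%N//.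
  by rewrite mulSn in ei; lia.
rewrite zout//.
have [/in_blockP[]// k k0 ik|ni1] := boolP (in_block L B i.+1).
  have [v1 v2 v3 v4] := vP _ k0.
  have ei : i.+1 = (L * B ^ k)%N.
    apply/eqP; rewrite eqn_leq (andP ik).1 andbT leqNgt; apply/negP => h.
    by move/negP: ni; apply; apply/in_blockP => //; exists k => //; lia.
  rewrite (zin k)// ei subnn.
  by move: v1; rewrite -ei.
rewrite zout// free_countS ni addn1.
exact: uA.
Qed.

(** Between [B ^ k] and [B ^ k.+1] there is at most one block, of length [B ^ k] and starting only
    at [L * B ^ k]; all earlier blocks have total length at most [B ^ k / L]. Each of these two
    contributions is at most [n / L] before time [n]. *)
Lemma free_count_ge (L B n : nat) : (0 < L)%N -> (L.+1 < B)%N ->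
  (L * n <= L * free_count L B n + n.*2)%N.
Proof.
move=> L0 LB.
pose d m := count (in_block L B) (iota 0 m).
have dS m : d m.+1 = (d m + in_block L B m)%N.
  by rewrite /d -addn1 iotaD count_cat /= addn0.
(* Truncated subtraction makes the [minn] term vanish until the block starts. *)
have dB k t : (B ^ k + t <= B ^ k.+1)%N ->
    (d (B ^ k + t) <= d (B ^ k) + minn (B ^ k + t - L * B ^ k) (B ^ k))%N.
  elim: t => [|t IH] ht; first by rewrite addn0 leq_addr.
  have {}IH := IH (ltac:(lia)).
  rewrite addnS dS.
  have [|_] := boolP (in_block L B (B ^ k + t)); last by lia.
  have et : trunc_log B (B ^ k + t) = k.
    by apply: trunc_log_eq; first lia; apply/andP; split; [exact: leq_addr|lia].
  by rewrite /in_block et mulSn => /andP[_ /andP[h1 h2]]; lia.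
have dL k : (L * d (B ^ k) <= B ^ k)%N.
  elim: k => [|k IH].
    by rewrite expn0 /d /= /in_block leqn0; case: B LB {dS dB d} => // B _; rewrite muln0.
  have h : (B ^ k <= B ^ k.+1)%N by rewrite leq_exp2l //; lia.
  have := dB k (B ^ k.+1 - B ^ k)%N; rewrite subnKC// => /(_ (leqnn _)) hd.
  have : (L * d (B ^ k.+1) <= L * (d (B ^ k) + B ^ k))%N.
    by rewrite leq_mul2l; apply/orP; right; lia.
  rewrite mulnDr => h1; apply: (leq_trans h1).
  apply: (@leq_trans (L.+1 * B ^ k)%N); first by rewrite mulSn; lia.
  by rewrite expnS leq_mul2r ltnW ?orbT.
have -> : (L * n = L * d n + L * free_count L B n)%N.
  by rewrite -mulnDr /d /free_count count_predC size_iota.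
rewrite addnC leq_add2l.
case: (posnP n) => [->|n0]; first by rewrite /d muln0.
have /andP[h1 h2] := trunc_log_bounds (ltac:(lia) : 1 < B)%N n0.
set k := trunc_log B n in h1 h2.
have := dB k (n - B ^ k)%N; rewrite subnKC// => /(_ (ltnW h2)) hd.
have := dL k => hk.
have [hn|hn] := leqP n (L * B ^ k).
  by have -> : (L * d n <= n.*2)%N; [have : (L * d n <= L * d (B ^ k))%N
    by [rewrite leq_mul2l; apply/orP; right; lia] |]; lia.
have : (L * d n <= L * (d (B ^ k) + B ^ k))%N.
  by rewrite leq_mul2l; apply/orP; right; lia.
by rewrite mulnDr; lia.
Qed.

(** * Oscillation of the potentials and comparison of averages *)

Lemma iter_left_shift (K i : nat) (x : fullshift K) (j : nat) :
  iter i (@left_shift K) x j = x (i + j)%N.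
Proof. by elim: i j => [//|i IH] j; rewrite iterS /left_shift IH addnS. Qed.

Lemma subshift_iter (K : nat) (A : 'M[nat]_K) (i : nat) (x : fullshift K) :
  subshift A x -> subshift A (iter i (@left_shift K) x).
Proof. by move=> xA k; rewrite !iter_left_shift addnS; exact: xA. Qed.

Lemma oscillation_le (R : realType) (K : nat) (A : 'M[nat]_K)
    (phi : nat -> fullshift K -> R) (n i : nat) (x y : fullshift K) :
  uniformly_equicontinuous A phi -> subshift A x -> subshift A y ->
  (forall j, (j < n)%N -> x j = y j) ->
  `|phi i x - phi i y| <= fine (sup_var A phi n).
Proof.
move=> [hfin _] xA yA xy.
rewrite -lee_fin fineK//.
apply: (@le_trans _ _ (var A n (phi i))); last first.
  by apply: ereal_sup_ubound; exists i.
apply: ereal_sup_ubound; exists x, y; split=> //.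
exists (mkseq x n); rewrite /cylinder /= size_mkseq; split=> //.
by apply/esym/eq_in_map => j; rewrite mem_iota add0n => /andP[_ /xy].
Qed.

Lemma oscillation_small (R : realType) (K : nat) (A : 'M[nat]_K)
    (phi : nat -> fullshift K -> R) (e : R) :
  uniformly_equicontinuous A phi -> 0 < e ->
  exists m, fine (sup_var A phi m) <= e.
Proof.
move=> [_ /fine_cvg/cvgrPdist_le/(_ e)] h e0.
have [N _ /(_ N (leqnn N))] := h e0.
by rewrite sub0r normrN => h1; exists N; apply: le_trans (ler_norm _) h1.
Qed.

Lemma sum_nat_norm_le (R : realType) (F : nat -> R) (a b : nat) (c : R) :
  (forall i, (a <= i < b)%N -> `|F i| <= c) ->
  `|\sum_(a <= i < b) F i| <= c * (b - a)%:R.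
Proof.
move=> h; apply: le_trans (ler_norm_sum _ _ _) _.
rewrite mulr_natr -sumr_const_nat big_nat [leRHS]big_nat.
exact: ler_sum.
Qed.

(** The window of agreement is a fixed proportion, about [1 / L.+1], of the elapsed time, so the
    growth of the sums across it determines the limit. *)
Lemma limit_eq_of_long_agreement (R : realType) (K : nat) (A : 'M[nat]_K)
    (phi : nat -> fullshift K -> R) (x z : fullshift K) (alpha gamma : R)
    (L r : nat) :
  uniformly_equicontinuous A phi -> (0 < L)%N ->
  subshift A x -> subshift A z ->
  average phi x n @[n --> \oo] --> alpha ->
  average phi z n @[n --> \oo] --> gamma ->
  (forall N, exists2 M, (N <= M)%N & forall i,
    (L * M + r <= i < L.+1 * M - r)%N -> z i = x i) ->
  gamma = alpha.
Proof.
move=> hequi L0 xA zA xa zg hM.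
apply/eqP/negPn/negP => neq.
(* T n / n tends to d, so T changes by about M d between L M and (L+1) M, but
   all but boundedly many of the summands D i in between are small. *)
pose d := gamma - alpha.
have d0 : 0 < `|d| by rewrite normr_gt0 subr_eq0.
(* The errors below total at most [e * M * (L.*2 + 3)]: [e * L * M] and [e * L.+1 * M] at the two
   ends of the window, [e * M] for the small summands and [e * M] for [C]. *)
pose e := `|d| / (L.*2 + 4)%:R.
have e0 : 0 < e by rewrite divr_gt0// ltr0n; lia.
have ed : `|d| = e * (L.*2 + 4)%:R by rewrite divfK// pnatr_eq0; lia.
pose D i := phi i (iter i (@left_shift K) z) - phi i (iter i (@left_shift K) x).
pose T n := \sum_(0 <= i < n) D i.
have [N1 _ hN1] : \forall n \near \oo, `|T n - n%:R * d| <= e * n%:R.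
  have : (average phi z n - average phi x n) @[n --> \oo] --> d by exact: cvgB.
  move=> /cvgrPdist_le/(_ e e0)[N _ hN].
  exists N => // n /hN /= hn.
  have [->|n0] := posnP n.
    by rewrite /T big_geq// !mul0r subrr normr0 mulr0.
  have nR : (0 : R) < n%:R by rewrite ltr0n.
  have -> : T n - n%:R * d = - (n%:R * (d - (average phi z n - average phi x n))).
    by rewrite /T /D sumrB /average; field; rewrite gt_eqF.
  by rewrite normrN normrM normr_nat mulrC ler_wpM2r ?ler0n.
have [m hm] := oscillation_small _ _ _ _ _ hequi e0.
pose c0 := fine (sup_var A phi 0).
(* This bounds the first [r] and the last [m + r] summands of the window by the oscillation at level
   0. *)
pose C := c0 * (r + (m + r))%:R.
have [N2 hN2] : exists N2 : nat, C <= e * N2%:R.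
  exists (Num.trunc (C / e)).+1; rewrite mulrC -ler_pdivrMr//.
  exact: ltW (truncnS_gt _).
have [M NM agree] := hM (N1 + N2 + (r + (m + r)) + 1)%N.
have D0 i : `|D i| <= c0.
  by apply: oscillation_le => //; apply: subshift_iter.
(* Stopping [m] earlier leaves [m] common coordinates after the shift by [i]. *)
have DE i : (L * M + r <= i < L.+1 * M - r - m)%N -> `|D i| <= e.
  move=> iM; apply: le_trans hm.
  apply: oscillation_le => //; [exact: subshift_iter|exact: subshift_iter|].
  by move=> j jm; rewrite !iter_left_shift; apply: agree; lia.
have TM : `|T (L.+1 * M)%N - T (L * M)%N| <= e * M%:R + C.
  have eM : (L.+1 * M = L * M + M)%N by rewrite mulSn addnC.
  rewrite /T (big_cat_nat (n := (L * M)%N)) //=; last by rewrite eM leq_addr.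
  rewrite addrC addrK.
  rewrite (big_cat_nat (n := (L * M + r)%N)) //=; [|lia|lia].
  rewrite (big_cat_nat (m := (L * M + r)%N) (n := (L.+1 * M - r - m)%N)) //=; [|lia|lia].
  have h1 := sum_nat_norm_le _ D (L * M) (L * M + r) c0 (fun i _ => D0 i).
  have h2 := sum_nat_norm_le _ D _ _ _ DE.
  have h3 := sum_nat_norm_le _ D (L.+1 * M - r - m) (L.+1 * M) c0 (fun i _ => D0 i).
  rewrite (_ : L * M + r - L * M = r)%N in h1; last lia.
  rewrite (_ : L.+1 * M - (L.+1 * M - r - m) = m + r)%N in h3; last lia.
  have h4 : e * (L.+1 * M - r - m - (L * M + r))%:R <= e * M%:R.
    by rewrite ler_pM2l// ler_nat; lia.
  have -> : C = c0 * r%:R + c0 * (m + r)%:R by rewrite /C natrD mulrDr.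
  have := ler_normD (\sum_(L * M <= i < L * M + r) D i) (\sum_(L * M + r <= i < L.+1 * M - r - m) D i + \sum_(L.+1 * M - r - m <= i < L.+1 * M) D i).
  have := ler_normD (\sum_(L * M + r <= i < L.+1 * M - r - m) D i) (\sum_(L.+1 * M - r - m <= i < L.+1 * M) D i).
  lra.
have M1 : (M <= L * M)%N by rewrite leq_pmull.
have t1 : `|T (L * M)%N - (L * M)%:R * d| <= e * (L * M)%:R.
  by apply: hN1 => /=; lia.
have t2 : `|T (L.+1 * M)%N - (L.+1 * M)%:R * d| <= e * (L.+1 * M)%:R.
  by apply: hN1 => /=; rewrite mulSn; lia.
have M0 : (0 : R) < M%:R by rewrite ltr0n; lia.
have CM : C <= e * M%:R.
  by apply: le_trans hN2 _; rewrite ler_pM2l// ler_nat; lia.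
have dM : `|d| * M%:R <= `|T (L.+1 * M)%N - T (L * M)%N| +
   `|T (L * M)%N - (L * M)%:R * d| + `|T (L.+1 * M)%N - (L.+1 * M)%:R * d|.
  rewrite -[X in _ * X <= _]normr_nat -normrM.
  have := ler_normD (T (L.+1 * M)%N - T (L * M)%N)
    (T (L * M)%N - (L * M)%:R * d).
  have := ler_normB (T (L.+1 * M)%N - T (L * M)%N +
    (T (L * M)%N - (L * M)%:R * d)) (T (L.+1 * M)%N - (L.+1 * M)%:R * d).
  have -> : T (L.+1 * M)%N - T (L * M)%N + (T (L * M)%N - (L * M)%:R * d) -
      (T (L.+1 * M)%N - (L.+1 * M)%:R * d) = d * M%:R.
    by rewrite mulSn natrD; ring.
  lra.
move: dM; rewrite ed; move: t1 t2 TM; rewrite mulSn -addnn !natrD !natrM.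
set q := L%:R; have := mulr_gt0 e0 M0.
nra.
Qed.

(** * Covers, decoding of words and entropy *)

Lemma esum_image_le (R : realType) (T T' : choiceType) (C : set T)
    (f : T -> T') (a : T' -> \bar R) (b : T -> \bar R) :
  (forall w, C w -> 0 <= b w)%E -> (forall w, C w -> a (f w) <= b w)%E ->
  (\esum_(v in f @` C) a v <= \esum_(w in C) b w)%E.
Proof.
move=> b0 ab.
have [->|/set0P[w0 _]] := eqVneq C set0; first by rewrite image_set0 !esum_set0.
have /choice[h hP] : forall v, exists w, (f @` C) v -> C w /\ f w = v.
  move=> v; have [[w Cw fw]|nv] := pselect ((f @` C) v); first by exists w.
  by exists w0 => /nv.
have hC : h @` (f @` C) `<=` C by move=> _ [v /hP[? _] <-].
apply: (@le_trans _ _ (\esum_(v in f @` C) b (h v))%E).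
  by apply: le_esum => v /hP[Chv fhv]; rewrite -{1}fhv; exact: ab.
rewrite -(esum_image _ h); last first.
  by move=> v v' /set_mem/hP[_ {2}<-] /set_mem/hP[_ {2}<-] ->.
rewrite -(setIidr hC) esum_mkcondr.
by apply: le_esum => w Cw; case: ifP => // _; exact: b0.
Qed.

(** A word of the cover that is a prefix of [z] decodes to a prefix of [u], so [f] carries covers of
    [E] to covers of [F]; the second hypothesis compares the weights. *)
Lemma hausdorff_level_coding (R : realType) (K : nat) (s s' : R)
    (E F : set (fullshift K)) (f : seq 'I_K -> seq 'I_K) (r r' : nat) :
  (forall w, (r < size w)%N -> (r' < size (f w))%N) ->
  (forall w, s * (size w)%:R <= s' * (size (f w))%:R) ->
  (forall u, F u -> exists2 z, E z & forall n, cylinder (f (mkseq z n)) u) ->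
  (hausdorff_level s' F r' <= hausdorff_level s E r)%E.
Proof.
move=> rr' ss' FE; apply/ereal_infP => _ [C [Cr CE] <-].
apply: le_trans (esum_image_le _ _ _ C f
  (fun w => (expR (- s' * (size w)%:R))%:E) _ _ _); last first.
- by move=> w Cw; rewrite lee_fin ler_expR !mulNr lerN2.
- by move=> w Cw; rewrite lee_fin expR_ge0.
apply: ereal_inf_lbound; exists (f @` C) => //; split.
  by move=> _ [w /Cr/rr' + <-].
move=> u /FE[z Ez zu].
have [w Cw zw] := CE _ Ez.
exists (f w); first by exists w.
by rewrite -[w in f w]zw; exact: zu.
Qed.

Lemma hausdorff_level_ndecr (R : realType) (K : nat) (s : R)
  (E : set (fullshift K)) : nondecreasing_seq (hausdorff_level s E).
Proof.
move=> r' r rr'; apply: (hausdorff_level_coding _ _ _ _ _ _ id) => //.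
- by move=> w; exact: leq_ltn_trans.
- by move=> u Eu; exists u => // n; rewrite /cylinder /= size_mkseq.
Qed.

Lemma hausdorff_measure_coding (R : realType) (K : nat) (s s' : R)
    (E F : set (fullshift K)) (f : seq 'I_K -> seq 'I_K) :
  (forall r', exists r, forall w, (r < size w)%N -> (r' < size (f w))%N) ->
  (forall w, s * (size w)%:R <= s' * (size (f w))%:R) ->
  (forall u, F u -> exists2 z, E z & forall n, cylinder (f (mkseq z n)) u) ->
  (hausdorff_measure s' F <= hausdorff_measure s E)%E.
Proof.
move=> rr' ss' FE.
have lim_sup t G := cvg_lim (@ereal_hausdorff R)
  (ereal_nondecreasing_cvgn (hausdorff_level_ndecr R K t G)).
rewrite /hausdorff_measure !lim_sup; apply: ge_ereal_sup => _ [r' _ <-].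
have [r hr] := rr' r'.
apply: le_trans (hausdorff_level_coding _ _ _ _ _ _ _ r r' hr ss' FE) _.
by apply: ereal_sup_ubound; exists r.
Qed.

(* f decodes words of E into words of F, shortening them by at most the factor
   s / (s + e); a decoding of cylinders need not come from a map E -> F. *)
Lemma htop_coding (R : realType) (K : nat) (E F : set (fullshift K)) :
  (forall s e : R, 0 <= s -> 0 < e -> exists f : seq 'I_K -> seq 'I_K, [/\
    forall r', exists r, forall w, (r < size w)%N -> (r' < size (f w))%N,
    forall w, s * (size w)%:R <= (s + e) * (size (f w))%:R &
    forall u, F u -> exists2 z, E z & forall n, cylinder (f (mkseq z n)) u]) ->
  (htop R F <= htop R E)%E.
Proof.
move=> h; rewrite /htop.
have [|/set0P[u Fu]] := eqVneq F set0; first by rewrite leNye.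
have [z0 Ez0] : E !=set0.
  by have [f [_ _ /(_ u Fu)[z Ez _]]] := h 0 1 (lexx _) ltr01; exists z.
rewrite ifF; last by apply/negbTE/set0P; exists z0.
apply/ereal_infP => _ [s [s0 sE] <-].
apply/lee_addgt0Pr => e e0.
apply: ereal_inf_lbound; exists (s + e) => //; split.
  by rewrite addr_ge0// ltW.
have [f [h1 h2 h3]] := h s e s0 e0.
exact: le_lt_trans (hausdorff_measure_coding _ _ _ _ _ _ _ h1 h2 h3) sE.
Qed.

(** * Deletion of the reserved positions, and the theorem *)

Definition free_subword (K L B : nat) (w : seq 'I_K) : seq 'I_K :=
  mask [seq ~~ in_block L B i | i <- iota 0 (size w)] w.

Lemma size_free_subword (K L B : nat) (w : seq 'I_K) :
  size (free_subword K L B w) = free_count L B (size w).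
Proof.
by rewrite size_mask ?size_map ?size_iota// count_map.
Qed.

(** A reserved time adds nothing and an unreserved one adds the next symbol of [u]; this makes
    [free_subword] a decoder for [htop_coding]. *)
Lemma free_subword_mkseq (K L B : nat) (z u : nat -> 'I_K) (n : nat) :
  (forall i, ~~ in_block L B i -> z i = u (free_count L B i)) ->
  free_subword K L B (mkseq z n) = mkseq u (free_count L B n).
Proof.
move=> zu; rewrite /free_subword size_mkseq /mkseq -map_mask -filter_mask.
elim: n => [//|n IH].
rewrite -addn1 iotaD filter_cat map_cat IH addn1 free_countS /=.
have [_|nn] := boolP (in_block L B n); first by rewrite cats0 addn0.
by rewrite iotaD map_cat /= zu.
Qed.

Theorem theorem2p3 (R : realType) (K : nat) (A : 'M[nat]_K)
    (phi : nat -> fullshift K -> R)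
    (hA : zero_one_mx A)
    (hsymb : every_symbol_occurs A)
    (hirr : aperiodic_irreducible A)
    (hcont : forall i, {within subshift A, continuous (phi i)})
    (hequi : uniformly_equicontinuous A phi)
    (hdom : exists alpha beta : R,
      [/\ alpha <> beta, level_set A phi alpha !=set0 &
          level_set A phi beta !=set0]) :
  htop R (divergence_set A phi) = htop R (subshift A).
Proof.
apply/eqP; rewrite eq_le; apply/andP; split; apply: htop_coding => s e s0 e0.
  (* The divergence set lies in the subshift, so the identity decodes. *)
  exists id; split.
  - by move=> r'; exists r'.
  - by move=> w; rewrite ler_wpM2r// lerDl ltW.
  - by move=> u [uA _]; exists u => // n; rewrite /cylinder /= size_mkseq.
have [alpha [beta [neq [x [xA xa]] [y [yA yb]]]]] := hdom.
have [r r0 Ar] := hirr.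
have hconn a b := connecting_path K A hA r a b (Ar a b).
(* This choice gives [s * L <= (s + e) * (L - 2)], the loss that [htop_coding] allows; also
   [L >= 3], so the lengths of decoded words tend to infinity. *)
pose L := (Num.trunc (s *+ 2 / e)).+3.
have Le : s *+ 2 <= e * (L%:R - 2).
  rewrite mulrC -ler_pdivrMr//; apply: le_trans (ltW (truncnS_gt _)) _.
  by rewrite /L -(addn2 (Num.trunc _).+1) natrD addrK.
(* Blocks are separated because [B > L.+1], and even the shortest one, of length [B], has room for
   two connecting words. *)
pose B := (L.+2 + r.*2)%N.
have L0 : (0 < L)%N by [].
have LB : (L.+1 < B)%N by rewrite /B; lia.
have rB : (r.*2 <= B)%N by rewrite /B; lia.
have BN k N : (N <= k)%N -> (N <= B ^ k)%N.
  by move=> Nk; apply: leq_trans Nk (ltnW (ltn_expl _ _)); rewrite /B; lia.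
have cP n := free_count_ge L B n L0 LB.
exists (free_subword K L B); split.
- move=> r'; exists (L * r')%N => w hw; rewrite size_free_subword.
  rewrite -(@ltn_pmul2l L)//; apply: leq_trans hw _.
  have := cP (size w); rewrite {1}/L mulSnr mulSnr mulSnr; lia.
- move=> w; rewrite size_free_subword.
  have h : L%:R * (size w)%:R <= L%:R * (free_count L B (size w))%:R +
      ((size w)%:R + (size w)%:R) :> R.
    by rewrite -!natrM -!natrD addnn ler_nat.
  have LR : (0 : R) < L%:R by rewrite ltr0n.
  have n0 : (0 : R) <= (size w)%:R by [].
  rewrite -(ler_pM2l LR).
  move: Le h n0; set l : R := L%:R; set n : R := (size w)%:R.
  set c : R := (free_count _ _ _)%:R => Le h n0.
  have h1 : (s + e) * ((l - 2) * n) <= (s + e) * (l * c).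
    by apply: ler_wpM2l; [lra | lra].
  have h2 : s *+ 2 * n <= e * (l - 2) * n by apply: ler_wpM2r.
  lra.
- move=> u uA.
  pose w k : fullshift K := if odd k then y else x.
  have wA k : subshift A (w k) by rewrite /w; case: ifP.
  have [z [zA zu zw]] := glue_blocks K A r L B hconn w u r0 L0 LB rB wA uA.
  exists z; last first.
    move=> n; rewrite (free_subword_mkseq _ _ _ _ u)//.
    by rewrite /cylinder /= size_mkseq.
  split=> // zc; apply: neq.
  transitivity (lim (average phi z n @[n --> \oo])).
    apply/esym/(limit_eq_of_long_agreement _ _ _ _ _ _ _ _ L r hequi L0 xA zA xa zc).
    (* Even exponents give the copies of [x], odd ones below those of [y]; [N.+1] keeps the even
       exponent positive. *)
    move=> N; exists (B ^ (N.+1).*2)%N; first by apply: BN; lia.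
    by move=> i /zw ->//; rewrite /w odd_double.
  apply: (limit_eq_of_long_agreement _ _ _ _ _ _ _ _ L r hequi L0 yA zA yb zc).
  move=> N; exists (B ^ (N.*2).+1)%N; first by apply: BN; lia.
  by move=> i /zw ->//; rewrite /w /= odd_double.
Qed.
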